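(* For $n\in\mathbb{N}$ let $\mathcal{K}_n=\{E\in\mathcal{N} : \max E=n,\ \min E>\omega_{2,3}(E),\ \text{and } |E|\neq2\}$. Then $|\mathcal{K}_{n+1}|=F_n$ for all $n\in\mathbb{N}$.
   Context: $\mathbb{N}=\{1,2,3,\dots\}$, and $\mathcal{N}$ denotes the collection of finite (nonempty where $\max,\min$ are used) subsets of $\mathbb{N}$. For $E\in\mathcal{N}$, $\omega_{2,3}(E)=\sum_{i\in E\setminus\{2,3\}}1=|E\setminus\{2,3\}|$. $(F_n)_{n\ge0}$ is the Fibonacci sequence: $F_0=0$, $F_1=1$, $F_n=F_{n-1}+F_{n-2}$ for $n\ge2$. *)

(* Defs.v *)
From mathcomp Require Import all_boot finmap.
From mathcomp Require Import boolp classical_sets functions cardinality.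

Set Implicit Arguments.
Unset Strict Implicit.
Unset Printing Implicit Defensive.

Local Open Scope classical_set_scope.
Local Open Scope nat_scope.

(* Here $\mathbb{N} = \{1, 2, 3, \dots\}$, so its finite subsets are the finite
   sets of [nat] avoiding [0]. *)
Definition finite_subsets : set {fset nat} := [set E | 0 \notin E].

(* Maximum and minimum of a nonempty finite set (both are [0] on the empty
   set). Using the maximum as the neutral value makes the minimum attained. *)
Definition fset_max (E : {fset nat}) : nat := \max_(i <- E) i.

Definition fset_min (E : {fset nat}) : nat := \big[minn/fset_max E]_(i <- E) i.

Definition omega23 (E : {fset nat}) : nat :=
  \sum_(i <- (E `\` [fset 2; 3])%fset) 1.

Definition calK (n : nat) : set {fset nat} :=
  [set E | [/\ finite_subsets E, E != fset0, fset_max E = n,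
               fset_min E > omega23 E & #|` E| <> 2]].

Fixpoint fib (n : nat) : nat :=
  match n with
  | 0 => 0
  | 1 => 1
  | (m.+1 as p).+1 => fib p + fib m
  end.

(* Main.v *)
(* The sets [E] with [max E = n.+1] and [min E > #|E|] (Schreier sets, up to
   a shift) are counted by [fib n]: those with the second largest element
   right below the maximum come, by shifting and adding a new maximum, from the
   sets of index [n - 2], and the others from those of index [n - 1]. Replacing
   [#|E|] by [omega23 E] and forbidding [#|E| = 2] keeps all these sets but the
   pairs [{a, n.+1}], [3 <= a <= n], and adds exactly the triples
   [{2, 3, n.+1}] and [{3, a, n.+1}], [4 <= a <= n], equally many. *)

Require Import Defs.
From mathcomp Require Import all_boot finmap.
From mathcomp Require Import boolp classical_sets functions cardinality.
From mathcomp Require Import zify.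

Local Open Scope classical_set_scope.
Local Open Scope card_scope.
Local Open Scope nat_scope.

Lemma card_eq_can (T U : Type) (A : set T) (B : set U) (f : T -> U) (g : U -> T) :
  (forall x, A x -> B (f x)) -> (forall y, B y -> A (g y)) ->
  (forall x, A x -> g (f x) = x) -> (forall y, B y -> f (g y) = y) -> B #= A.
Proof.
move=> fAB gBA fK gK; have -> : B = f @` A.
  apply/seteqP; split => [y By | _ [x Ax <-]]; last exact: fAB.
  by exists (g y); [exact: gBA | exact: gK].
by apply: inj_card_eq => x y /set_mem/fK {2}<- /set_mem/fK {2}<- ->.
Qed.

(** * Maxima and minima as pointwise bounds *)

Lemma fset_max_ge (E : {fset nat}) (x : nat) : x \in E -> x <= fset_max E.
Proof. by move=> xE; exact: (leq_bigmax_seq (F := id)). Qed.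

Lemma fset_maxP (E : {fset nat}) (n : nat) :
  E != fset0 -> fset_max E = n <-> n \in E /\ (forall x : nat, x \in E -> x <= n).
Proof.
move=> /fset0Pn[y yE]; split => [<- | [nE En]].
  split => [|x]; last exact: fset_max_ge.
  rewrite /fset_max big_tnth.
  have s0 : 0 < #|` E| by rewrite cardfs_gt0; apply/fset0Pn; exists y.
  case: (@eq_bigmax _ (tnth (in_tuple E))) => [|i ->]; first by rewrite card_ord.
  exact: (mem_tnth i (in_tuple E)).
apply/eqP; rewrite eqn_leq fset_max_ge // andbT.
by apply/bigmax_leqP_seq => x xE _; exact: En.
Qed.

Lemma lt_fset_minP (E : {fset nat}) (m : nat) :
  E != fset0 -> m < fset_min E <-> (forall x : nat, x \in E -> m < x).
Proof.
move=> /fset0Pn[y yE]; have bigminP (s : seq nat) (d : nat) :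
  m < \big[minn/d]_(i <- s) i <-> m < d /\ (forall x : nat, x \in s -> m < x).
  elim: s => [|a s IHs]; first by rewrite big_nil; split=> [|[]].
  rewrite big_cons leq_min; split => [/andP[ma /IHs[md ms]] | [md ms]].
    by split => // x; rewrite inE => /orP[/eqP->|/ms].
  rewrite ms ?mem_head //=; apply/IHs; split => // x xs.
  by rewrite ms // inE xs orbT.
rewrite bigminP; split => [[]// | mE]; split => //.
(* The default value [fset_max E] adds no constraint: it is at least [y], hence above [m]. *)
exact: leq_trans (mE _ yE) (fset_max_ge _ _ yE).
Qed.

Lemma card_omega23 (E : {fset nat}) :
  #|` E| = omega23 E + (2 \in E) + (3 \in E).
Proof.
rewrite /omega23 sum1_size -fsetDDl (cardfsD1 2 E) (cardfsD1 3 (E `\ 2)%fset).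
by rewrite !inE /=; lia.
Qed.

(** Adding the indicators of 2 and 3 to both sides of [omega23 E < x] leaves the plain cardinal on
    the left, which is easy to track when elements are added or removed. *)
Lemma calKP (n : nat) (E : {fset nat}) :
  calK n E <-> [/\ n \in E, #|` E| <> 2 & forall x : nat, x \in E ->
    0 < x <= n /\ #|` E| < x + (2 \in E) + (3 \in E)].
Proof.
have cE := card_omega23 E; split.
  move=> [E0 En /(fset_maxP _ _ En)[nE leEn] /(lt_fset_minP _ _ En) minE E2].
  split => // x xE; rewrite leEn // cE; have := minE _ xE; lia.
move=> [nE E2 HE]; have En : E != fset0 by apply/fset0Pn; exists n.
split => //.
- by apply/negP => /HE[].
- by apply/(fset_maxP _ _ En); split => // x /HE[/andP[]].
- by apply/(lt_fset_minP _ _ En) => x /HE[_]; lia.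
Qed.

(** * Removing the maximum *)

(* The tails [E `\ max E] of the members [E] of [calK n.+1]. *)
Definition calK_tail (n : nat) : set {fset nat} :=
  [set E | #|` E| <> 1 /\ forall x : nat, x \in E ->
    x <= n /\ #|` E|.+1 < x + (2 \in E) + (3 \in E)].

(* The tails of the sets [E] with [max E = n.+1] and [min E > #|` E|]. *)
Definition schreier_tail (n : nat) : set {fset nat} :=
  [set E | forall x : nat, x \in E -> #|` E|.+1 < x <= n].

(** The element 1 is itself counted by [omega23], so a minimum equal to 1 could not exceed it. *)
Lemma calK_ge2 (n : nat) (E : {fset nat}) (x : nat) :
  calK n E -> x \in E -> 2 <= x.
Proof.
move=> /calKP[_ _ HE] xE; have [xn cE] := HE x xE.
have [//|x1] := ltnP 1 x; have {}x1 : x = 1 by lia.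
rewrite {}x1 in xE cE *; move: cE; rewrite (cardfsD1 1) (cardfsD1 2 (E `\ 1)%fset).
rewrite (cardfsD1 3 (E `\ 1 `\ 2)%fset) !inE /= xE; lia.
Qed.

(** The two indicators sum to at most the cardinal of [E], so the bound leaves [1 < x]. *)
Lemma calK_tail_ge2 (n : nat) (E : {fset nat}) (x : nat) :
  calK_tail n E -> x \in E -> 2 <= x.
Proof.
move=> [_ HE] xE; have [xn cE] := HE x xE.
have [//|x1] := ltnP 1 x; move: cE.
rewrite (cardfsD1 2 E) (cardfsD1 3 (E `\ 2)%fset) !inE /=; lia.
Qed.

Lemma calK_fsetD1 (n : nat) (E : {fset nat}) :
  calK n.+1 E -> calK_tail n (E `\ n.+1)%fset.
Proof.
move=> KE; have /calKP[nE E2 HE] := KE.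
have cE := cardfsD1 n.+1 E; rewrite nE in cE.
split => [|x]; first by lia.
move=> xE'; have := xE'; rewrite in_fsetD1 => /andP[xn xE].
have [/andP[_ le_xn] cx] := HE x xE; have x2 := calK_ge2 _ _ _ KE xE.
have {}le_xn : x <= n by lia.
split => //; have [n2|n3] := leqP n 2; last first.
  have mE (y : nat) : y <= n -> (y \in E `\ n.+1)%fset = (y \in E).
    by rewrite in_fsetD1 => yn; case: eqP => //; lia.
  by rewrite !mE; lia.
have sE' : (E `\ n.+1 `<=` [fset 2])%fset.
  apply/fsubsetP => y; rewrite in_fsetD1 in_fset1 => /andP[yn yE].
  have [/andP[_ le_yn] _] := HE y yE; have := calK_ge2 _ _ _ KE yE; lia.
have := fsubset_leq_card sE'; rewrite cardfs1.
have : 0 < #|` (E `\ n.+1)%fset| by rewrite cardfs_gt0; apply/fset0Pn; exists x.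
lia.
Qed.

Lemma calK_fsetU1 (n : nat) (E : {fset nat}) :
  0 < n -> calK_tail n E -> calK n.+1 (n.+1 |` E)%fset.
Proof.
move=> n0 [E1 HE]; have nE : n.+1 \notin E by apply/negP => /HE[]; lia.
apply/calKP; rewrite cardfsU1 nE; split; [by rewrite !inE eqxx | lia |].
have leE (y : nat) : (y \in E) <= (y \in n.+1 |` E)%fset.
  by rewrite in_fset1U; case: (y \in E); rewrite ?orbT.
move=> x; rewrite in_fset1U => /orP[/eqP->|xE].
  split; first by lia.
  (* The new maximum inherits the bound from any element of [E]; for empty [E] the bound follows
     from [0 < n]. *)
  have [->|/fset0Pn[y /HE]] := eqVneq E fset0; first by rewrite cardfs0; lia.
  by have := leE 2; have := leE 3; lia.
have [xn cx] := HE x xE; split; last by have := leE 2; have := leE 3; lia.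
by have := calK_tail_ge2 n E x (conj E1 HE) xE; lia.
Qed.

Lemma card_calK (n : nat) : 0 < n -> calK n.+1 #= calK_tail n.
Proof.
move=> n0; apply: (@card_eq_can _ _ _ _ (fun E => n.+1 |` E)%fset
  (fun E => E `\ n.+1)%fset).
- by move=> E; exact: calK_fsetU1.
- by move=> E; exact: calK_fsetD1.
- by move=> E [_ HE]; apply: fsetU1K; apply/negP => /HE[]; lia.
- by move=> E /calKP[nE _ _]; exact: fsetD1K.
Qed.

(** * Exchanging singletons for pairs containing 3 *)

(* Trades the singletons [{a}], not allowed as tails in [calK], for the pairs
   [{3, a}] ([{2, 3}] when [a = 3]), which are the new ones allowed. *)
Definition swap_in (E : {fset nat}) : {fset nat} :=
  if #|` E| == 1 then
    if 3 \in E then [fset 2; 3]%fset else (3 |` E)%fset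
  else E.

Definition swap_out (E : {fset nat}) : {fset nat} :=
  if 3 \in E then
    if 2 \in E then [fset 3]%fset else (E `\ 3)%fset
  else E.

Lemma card1_mem (E : {fset nat}) (x : nat) :
  #|` E| = 1 -> x \in E -> E = [fset x]%fset.
Proof.
move=> E1 xE; apply/eqP; rewrite eq_sym eqEfcard fsub1set xE.
by rewrite cardfs1 E1.
Qed.

(** The bound at 3, or the one at 2 when 2 is present, gives cardinal at most 2; cardinal 1 is
    forbidden. *)
Lemma calK_tail3 (n : nat) (E : {fset nat}) :
  calK_tail n E -> 3 \in E -> #|` E| = 2.
Proof.
move=> [E1 HE] E3; have := cardfsD1 3 E; rewrite E3.
have [_] := HE 3 E3; rewrite E3; have [E2|] := boolP (2 \in E); last lia.
have [_] := HE 2 E2; rewrite E2 E3; lia.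
Qed.

Lemma swap_inP (n : nat) (E : {fset nat}) :
  schreier_tail n E -> calK_tail n (swap_in E).
Proof.
move=> HE; rewrite /swap_in; case: eqP => [E1|E1]; last first.
  by split => // x /HE; lia.
have [E3|E3] := boolP (3 \in E).
  have := HE 3 E3; rewrite E1 => n3.
  split; first by rewrite cardfs2.
  by move=> x; rewrite cardfs2 !inE /= => /orP[]/eqP->; lia.
split; first by rewrite cardfsU1 E3 E1.
move=> x; rewrite cardfsU1 E3 E1 !inE /= => /orP[/eqP->|xE].
  (* The element already in [E] shows that the added 3 is at most [n]. *)
  have /fset0Pn[y yE] : E != fset0 by rewrite -cardfs_gt0 E1.
  by have := HE y yE; have : y <> 3 by [move=> y3; rewrite -y3 yE in E3]; lia.
by have := HE x xE; have : x <> 3 by [move=> x3; rewrite -x3 xE in E3]; lia.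
Qed.

Lemma swap_outP (n : nat) (E : {fset nat}) :
  calK_tail n E -> schreier_tail n (swap_out E).
Proof.
move=> KE; have [E1 HE] := KE; rewrite /swap_out.
have [E3|E3] := boolP (3 \in E).
  have c2 := calK_tail3 _ _ KE E3; have [n3 _] := HE 3 E3.
  case: (boolP (2 \in E)) => E2 x.
    by rewrite in_fset1 cardfs1 => /eqP->; lia.
  rewrite in_fsetD1 => /andP[x3 xE]; have := cardfsD1 3 E.
  rewrite E3 c2 => c3; have [xn _] := HE x xE.
  have x2 : x <> 2 by move=> x2; rewrite -x2 xE in E2.
  by have := calK_tail_ge2 _ _ _ KE xE; lia.
move=> x xE; have [xn cx] := HE x xE.
(* With 2 but not 3 in [E], the bound at 2 forces the forbidden cardinal 1. *)
have [E2|E2] := boolP (2 \in E); last by lia.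
have := cardfsD1 2 E; have [_] := HE 2 E2; rewrite E2; lia.
Qed.

Lemma swap_inK (n : nat) (E : {fset nat}) :
  schreier_tail n E -> swap_out (swap_in E) = E.
Proof.
move=> HE; rewrite /swap_in; case: eqP => [E1|E1].
  have [E3|E3] := boolP (3 \in E).
    by rewrite /swap_out !inE /= -(card1_mem _ _ E1 E3).
  have E2 : 2 \notin E by apply/negP => /HE; lia.
  by rewrite /swap_out !in_fset1U /= (negPf E2) fsetU1K.
(* The Schreier bound at 3 allows only cardinal 1, so here 3 is absent and [swap_out] changes
   nothing. *)
rewrite /swap_out ifN //; apply/negP => E3.
by have := HE 3 E3; have := cardfsD1 3 E; rewrite E3; lia.
Qed.

Lemma swap_outK (n : nat) (E : {fset nat}) :
  calK_tail n E -> swap_in (swap_out E) = E.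
Proof.
move=> KE; have [E1 HE] := KE; rewrite /swap_out.
have [E3|E3] := boolP (3 \in E); last by rewrite /swap_in; case: eqP.
have c2 := calK_tail3 _ _ KE E3; have [E2|E2] := boolP (2 \in E).
  rewrite /swap_in cardfs1 !inE /=; apply/eqP.
  by rewrite eqEfcard cardfs2 c2 fsubUset !fsub1set E2 E3.
have c3 : #|` (E `\ 3)%fset| = 1 by have := cardfsD1 3 E; rewrite E3 c2; lia.
by rewrite /swap_in c3 in_fsetD1 eqxx /= fsetD1K.
Qed.

Lemma card_calK_tail (n : nat) : calK_tail n #= schreier_tail n.
Proof.
apply: (@card_eq_can _ _ _ _ swap_in swap_out).
- exact: swap_inP.
- exact: swap_outP.
- exact: swap_inK.
- exact: swap_outK.
Qed.

(** * The Fibonacci recurrence for Schreier tails *)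

Definition shift_cons (n : nat) (E : {fset nat}) : {fset nat} :=
  (n |` [fset x.+1 | x in E])%fset.

Definition shift_uncons (n : nat) (E : {fset nat}) : {fset nat} :=
  [fset x.-1 | x in (E `\ n)%fset]%fset.

(* Sets with [n.+2] as an element lose it and are shifted down by one; the
   others are the sets of the previous index. *)
Fixpoint schreier_tails (n : nat) : {fset {fset nat}} :=
  match n with
  | 0 => fset0
  | 1 => [fset fset0]
  | (m.+1 as p).+1 =>
    schreier_tails p `|` [fset shift_cons m.+2 E | E in schreier_tails m]
  end%fset.

Lemma schreier_tailsSS (n : nat) :
  schreier_tails n.+2 = (schreier_tails n.+1 `|`
    [fset shift_cons n.+2 E | E in schreier_tails n])%fset.
Proof. by []. Qed.

Lemma fibSS (n : nat) : fib n.+2 = fib n.+1 + fib n.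
Proof. by []. Qed.

Lemma mem_shift (E : {fset nat}) (x : nat) :
  (x.+1 \in [fset y.+1 | y in E]%fset) = (x \in E).
Proof. exact: (mem_imfset _ _ succn_inj). Qed.

Lemma card_shift (E : {fset nat}) : #|` [fset y.+1 | y in E]%fset| = #|` E|.
Proof. exact: (card_imfset _ _ succn_inj). Qed.

Lemma notin_shift (n : nat) (E : {fset nat}) :
  (forall x : nat, x \in E -> x <= n) -> n.+2 \notin [fset y.+1 | y in E]%fset.
Proof. by move=> HE; rewrite mem_shift; apply/negP => /HE; lia. Qed.

Lemma shift_consK (n : nat) (E : {fset nat}) :
  (forall x : nat, x \in E -> x <= n) -> shift_uncons n.+2 (shift_cons n.+2 E) = E.
Proof.
move=> /notin_shift nE; rewrite /shift_uncons /shift_cons fsetU1K //.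
apply/fsetP => x; apply/imfsetP/idP => [[_ /imfsetP[y yE ->] ->] // | xE].
by exists x.+1 => //=; rewrite mem_shift.
Qed.

(** The successor undoes the predecessor only away from 0, whence [0 \notin E]. *)
Lemma shift_unconsK (n : nat) (E : {fset nat}) :
  n.+2 \in E -> 0 \notin E ->
  [fset x.+1 | x in shift_uncons n.+2 E]%fset = (E `\ n.+2)%fset.
Proof.
move=> nE E0; apply/fsetP => x; apply/imfsetP/idP => [[_ /imfsetP[y /= yE ->] ->]|].
  by case: y yE => // /fsetD1P[_]; rewrite (negPf E0).
case: x => [/fsetD1P[_]|x xE]; first by rewrite (negPf E0).
by exists x => //=; apply/imfsetP; exists x.+1.
Qed.

(** The cardinal and the old elements all grow by one, which preserves the bound. With [E] empty,
    the new element [n.+2] must exceed 2, which needs [0 < n]. *)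
Lemma schreier_shift_cons (n : nat) (E : {fset nat}) :
  0 < n -> schreier_tail n E -> schreier_tail n.+2 (shift_cons n.+2 E).
Proof.
move=> n0 HE; have nE : n.+2 \notin [fset y.+1 | y in E]%fset.
  by apply: notin_shift => x /HE; lia.
move=> x; rewrite cardfsU1 nE card_shift in_fset1U.
case/orP => [/eqP->|/imfsetP[y /HE yE ->]]; last by lia.
have [->|/fset0Pn[y /HE]] := eqVneq E fset0; first by rewrite cardfs0; lia.
lia.
Qed.

(** The empty set satisfies [schreier_tail 0], but the family of index 0 is kept empty to match
    [fib 0 = 0]; hence the condition [0 < n]. *)
Lemma schreier_tailsP (n : nat) (E : {fset nat}) :
  E \in schreier_tails n <-> 0 < n /\ schreier_tail n E.
Proof.
elim/ltn_ind: n E => -[|[|n]] IH E.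
- by rewrite in_fset0; split => // -[].
- rewrite in_fset1; split => [/eqP-> // | [_ HE]].
  by rewrite -[_ == _]negbK; apply/negP => /fset0Pn[x /HE]; lia.
have {IH} [IH1 IH] := (IH n.+1 (ltnSn _), IH n (leqnSn _)).
rewrite schreier_tailsSS in_fsetU; split => [/orP[/IH1[_ HE]|/imfsetP[F /= /IH[n0 HF] ->]]|].
- by split => // x /HE; lia.
- by split => //; exact: schreier_shift_cons.
move=> [_ HE]; have [nE|nE] := boolP (n.+2 \in E); apply/orP.
  have E0 : 0 \notin E by apply/negP => /HE; lia.
  right; apply/imfsetP; exists (shift_uncons n.+2 E) => /=; last first.
    by rewrite /shift_cons shift_unconsK // fsetD1K.
  have cE : #|` E| = #|` shift_uncons n.+2 E|.+1.
    by rewrite -(card_shift (shift_uncons n.+2 E)) shift_unconsK // (cardfsD1 n.+2 E) nE.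
  (* As [E] is nonempty, its bound at [n.+2] reads at least [2 < n.+2]. *)
  apply/IH; split; first by have := HE _ nE; lia.
  move=> x; rewrite -mem_shift shift_unconsK // => /fsetD1P[xn /HE].
  rewrite cE; lia.
left; apply/IH1; split => // x xE; have := HE x xE.
have : x <> n.+2 by move=> xn; rewrite -xn xE in nE.
lia.
Qed.

(** The union is disjoint because [n.+2] lies in every [shift_cons n.+2 E] and in no set of index
    [n.+1]; the image keeps its cardinal because [shift_uncons] inverts [shift_cons]. *)
Lemma card_schreier_tails (n : nat) : #|` schreier_tails n| = fib n.
Proof.
elim/ltn_ind: n => -[|[|n]] IH; rewrite ?cardfs0 ?cardfs1 //.
have disj : (schreier_tails n.+1 `&`
    [fset shift_cons n.+2 E | E in schreier_tails n] = fset0)%fset.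
  apply/eqP; rewrite -[_ == _]negbK; apply/negP => /fset0Pn[E].
  rewrite in_fsetI => /andP[/schreier_tailsP[_ HE] /imfsetP[F _ EF]].
  by have := HE n.+2; rewrite EF in_fset1U eqxx; lia.
rewrite schreier_tailsSS fibSS cardfsU disj cardfs0 subn0 -!IH //.
rewrite card_in_imfset // => E F /schreier_tailsP[_ HE] /schreier_tailsP[_ HF] EF.
rewrite -(shift_consK n E) => [|x /HE]; last by lia.
by rewrite EF shift_consK // => x /HF; lia.
Qed.

Theorem theorem1p5 (n : nat) (hn : 0 < n) : calK n.+1 #= `I_(fib n).
Proof.
apply: card_eq_trans (card_calK n hn) _.
apply: card_eq_trans (card_calK_tail n) _.
have -> : schreier_tail n = [set` schreier_tails n].
  by apply/seteqP; split => E /=; [move=> HE | case/schreier_tailsP];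
    [apply/schreier_tailsP |].
by apply/card_eq_fsetP; exact: card_schreier_tails.
Qed.
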